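(* Let $n\ge 3$ and $\varepsilon\in\{1,-1\}$. Then the $\varepsilon$-space $(\mathbb{R}^n,g_\varepsilon)$ is an Ivanov--Petrova manifold.
   Context: $\varepsilon$-space: for $n\ge 3$ and $\varepsilon=\pm1$, it is the Lorentzian manifold $(\mathbb{R}^n,g_\varepsilon)$ with coordinates $(x_1,\dots,x_n)$ and metric $g_\varepsilon=\sum_{i=1}^{n-2}(dx_i)^2-dx_{n-1}dx_n+\varepsilon\left(\sum_{i=1}^{n-2}x_i^2\right)(dx_{n-1})^2$ (symmetric product, so $g_\varepsilon(\partial_{n-1},\partial_n)=-\tfrac12$). Curvature convention: $R(X,Y)=\nabla_{[X,Y]}-[\nabla_X,\nabla_Y]$, with $\nabla$ the Levi-Civita connection. Skew-symmetric curvature operator: for a pseudo-Riemannian manifold $(M,g)$, a point $p$, and an oriented non-degenerate $2$-plane $\pi\subset T_pM$ with oriented basis $\{u,v\}$, $R(\pi)=|g(u,u)g(v,v)-g(u,v)^2|^{-1/2}R(u,v)$, an endomorphism of $T_pM$ independent of the choice of oriented basis. $(M,g)$ is an Ivanov--Petrova (IP) manifold if, at each point $p$, the eigenvalues (complex, counted with multiplicity) of $R(\pi)$ do not depend on the oriented non-degenerate $2$-plane $\pi\subset T_pM$; they may vary with $p$. *)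

(* Defs.v *)
From HB Require Import structures.
From mathcomp Require Import all_boot all_order all_algebra.
From mathcomp Require Import all_classical all_reals all_analysis.
From mathcomp Require Import complex zify ring.

Set Implicit Arguments.
Unset Strict Implicit.
Unset Printing Implicit Defensive.

Import Order.TTheory GRing.Theory Num.Theory.
Import numFieldNormedType.Exports.

Local Open Scope ring_scope.

Section PseudoRiemannian.
Variables (R : realType) (n : nat).
Implicit Types (p u v w : 'rV[R]_n) (f : 'rV[R]_n -> R).

Definition partial (i : 'I_n) f : 'rV[R]_n -> R := 'D_(delta_mx 0 i) f.

(* C^infinity: every iterated partial derivative is (Frechet) differentiable. *)
Definition smooth f : Prop :=
  forall (s : seq 'I_n) p, differentiable (foldr partial f s) p.

(* A pseudo-Riemannian metric on R^n in the global coordinates; its signature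
   is constant because R^n is connected. *)
Record pseudo_metric := PseudoMetric {
  gmx : 'rV[R]_n -> 'M[R]_n;
  gmx_sym : forall p, (gmx p)^T = gmx p;
  gmx_unit : forall p, gmx p \in unitmx;
  gmx_smooth : forall i j, smooth (fun p => gmx p i j) }.

Variable g : pseudo_metric.

Definition gdot p u v : R := (u *m gmx g p *m v^T) 0 0.

Definition vfield := 'rV[R]_n -> 'rV[R]_n.
Implicit Types X Y Z : vfield.

(* Componentwise derivative of the field Y along X. *)
Definition dfield X Y : vfield :=
  fun p => \row_k 'D_(X p) (fun q => Y q 0 k) p.

Definition lie X Y : vfield := fun p => dfield X Y p - dfield Y X p.

Definition christoffel (k i j : 'I_n) p : R :=
  2^-1 * \sum_l invmx (gmx g p) k l *
    (partial i (fun q => gmx g q j l) p + partial j (fun q => gmx g q i l) p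
     - partial l (fun q => gmx g q i j) p).

(* Levi-Civita connection; nabla_torsion_free and nabla_metric below are the
   two properties that characterize it. *)
Definition nabla X Y : vfield := fun p =>
  dfield X Y p +
  \row_k \sum_i \sum_j christoffel k i j p * X p 0 i * Y p 0 j.

(* R(X,Y)Z with R(X,Y) = nabla_[X,Y] - [nabla_X, nabla_Y]. *)
Definition curvature X Y Z : vfield := fun p =>
  nabla (lie X Y) Z p - (nabla X (nabla Y Z) p - nabla Y (nabla X Z) p).

(* R(u,v) on T_pM, as the matrix acting on row vectors (w |-> w *m _).  The
   curvature being a tensor, tangent vectors at p are extended to the fields
   with constant coordinates. *)
Definition curv_op p u v : 'M[R]_n :=
  lin1_mx (fun w => curvature (fun=> u) (fun=> v) (fun=> w) p).

(* {u, v} is a basis of a 2-plane on which g_p is non-degenerate. *)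
Definition nondeg_basis p u v : Prop :=
  row_free (col_mx u v) /\
  forall w, (w <= col_mx u v)%MS ->
    (forall w', (w' <= col_mx u v)%MS -> gdot p w w' = 0) -> w = 0.

(* R(pi) for the plane pi oriented by the ordered basis (u, v). *)
Definition skew_curv_op p u v : 'M[R]_n :=
  (Num.sqrt `|gdot p u u * gdot p v v - gdot p u v ^+ 2|)^-1
    *: curv_op p u v.

(* Algebraic multiplicity of the complex number z as an eigenvalue of A (0 when
   z is not an eigenvalue). *)
Definition eig_mult (A : 'M[R]_n) (z : R[i]) : nat :=
  mup z (char_poly (map_mx (real_complex R) A)).

(* Quantifying over all ordered bases amounts to quantifying over the oriented
   planes, R(pi) being independent of the oriented basis of pi. *)
Definition ivanov_petrova : Prop :=
  forall p u v u' v', nondeg_basis p u v -> nondeg_basis p u' v' ->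
    forall z, eig_mult (skew_curv_op p u v) z
            = eig_mult (skew_curv_op p u' v') z.

Lemma gmxC p i j : gmx g p i j = gmx g p j i.
Proof. by rewrite -[in LHS]gmx_sym mxE. Qed.

Lemma christoffelC k i j p : christoffel k i j p = christoffel k j i p.
Proof.
rewrite /christoffel; congr (_ * _); apply: eq_bigr => l _; congr (_ * _).
rewrite [in LHS]addrC [in RHS]addrC; congr (- _ + _); last exact: addrC.
by congr (partial l _ p); apply/funext => q; rewrite gmxC.
Qed.

Lemma nabla_torsion_free X Y p : nabla X Y p - nabla Y X p = lie X Y p.
Proof.
rewrite /nabla /lie opprD addrACA -[RHS]addr0; congr (_ + _).
apply/eqP; rewrite subr_eq0; apply/eqP/rowP => k; rewrite !mxE exchange_big /=.
apply: eq_bigr => i _; apply: eq_bigr => j _.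
by rewrite christoffelC mulrAC.
Qed.

Lemma gmx_diff i j p : differentiable (fun q => gmx g q i j) p.
Proof. exact: (gmx_smooth g i j [::] p). Qed.

Lemma gdotE p u v : gdot p u v = \sum_i \sum_j u 0 i * gmx g p i j * v 0 j.
Proof.
rewrite /gdot mxE exchange_big /=; apply: eq_bigr => j _.
by rewrite !mxE mulr_suml.
Qed.

Lemma derive_partial f p v : differentiable f p ->
  'D_v f p = \sum_i v 0 i * partial i f p.
Proof.
move=> df; rewrite /partial deriveE// {1}(row_sum_delta v) linear_sum /=.
by apply: eq_bigr => i _; rewrite linearZ /= deriveE.
Qed.

Lemma christoffel_lower i j k p :
  \sum_m christoffel m k i p * gmx g p m j =
  2^-1 * (partial k (fun q => gmx g q i j) p + partial i (fun q => gmx g q k j) p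
          - partial j (fun q => gmx g q k i) p).
Proof.
set G := fun l => partial k (fun q => gmx g q i l) p +
  partial i (fun q => gmx g q k l) p - partial l (fun q => gmx g q k i) p.
transitivity (2^-1 * \sum_m \sum_l G l * (invmx (gmx g p) m l * gmx g p m j)).
  rewrite mulr_sumr; apply: eq_bigr => m _; rewrite /christoffel -mulrA.
  by rewrite mulr_suml; congr (_ * _); apply: eq_bigr => l _; rewrite mulrAC mulrC.
rewrite exchange_big /=; congr (_ * _).
rewrite (bigD1 j) //= [X in _ + X]big1 ?addr0 => [|l lj].
  rewrite -mulr_sumr (_ : \sum_m _ = (gmx g p *m invmx (gmx g p)) j j).
    by rewrite mulmxV ?gmx_unit// mxE eqxx mulr1.
  by rewrite mxE; apply: eq_bigr => m _; rewrite mulrC gmxC.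
rewrite -mulr_sumr (_ : \sum_m _ = (gmx g p *m invmx (gmx g p)) j l).
  by rewrite mulmxV ?gmx_unit// mxE eq_sym (negbTE lj) mulr0.
by rewrite mxE; apply: eq_bigr => m _; rewrite mulrC gmxC.
Qed.

Lemma christoffel_metric i j k p :
  partial k (fun q => gmx g q i j) p =
  \sum_m christoffel m k i p * gmx g p m j +
  \sum_m christoffel m k j p * gmx g p i m.
Proof.
under [X in _ + X]eq_bigr do rewrite gmxC.
have gC a b : (fun q => gmx g q a b) = (fun q => gmx g q b a).
  by apply/funext => q; rewrite gmxC.
rewrite !christoffel_lower (gC j i) (gC k i) (gC k j).
by field.
Qed.

Lemma nabla_metric X Y Z p :
  (forall i, differentiable (fun q => Y q 0 i) p) ->
  (forall i, differentiable (fun q => Z q 0 i) p) ->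
  'D_(X p) (fun q => gdot q (Y q) (Z q)) p =
  gdot p (nabla X Y p) (Z p) + gdot p (Y p) (nabla X Z p).
Proof.
move=> dY dZ; set v := X p.
pose h i j q := Y q 0 i * gmx g q i j * Z q 0 j.
have dYv i : derivable (fun q => Y q 0 i) p v by exact: diff_derivable.
have dZv i : derivable (fun q => Z q 0 i) p v by exact: diff_derivable.
have dgv i j : derivable (fun q => gmx g q i j) p v.
  by apply: diff_derivable; exact: gmx_diff.
have dYg i j : derivable (fun q => Y q 0 i * gmx g q i j) p v.
  exact: (derivableM (dYv i) (dgv i j)).
have dh i j : derivable (h i j) p v by exact: (derivableM (dYg i j) (dZv j)).
have -> : (fun q => gdot q (Y q) (Z q)) = \sum_i \sum_j h i j.
  apply/funext => q; rewrite gdotE fct_sumE; apply: eq_bigr => i _.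
  by rewrite fct_sumE.
rewrite derive_sum => [|i]; last exact: derivable_sum.
under eq_bigr do rewrite derive_sum//.
have Dh i j : 'D_v (h i j) p =
    'D_v (fun q => Y q 0 i) p * gmx g p i j * Z p 0 j +
    Y p 0 i * 'D_v (fun q => gmx g q i j) p * Z p 0 j +
    Y p 0 i * gmx g p i j * 'D_v (fun q => Z q 0 j) p.
  rewrite (deriveM (dYg i j) (dZv j)) (deriveM (dYv i) (dgv i j)).
  by rewrite /GRing.scale /=; ring.
have DG i j : 'D_v (fun q => gmx g q i j) p =
    \sum_k v 0 k * \sum_m christoffel m k i p * gmx g p m j +
    \sum_k v 0 k * \sum_m christoffel m k j p * gmx g p i m.
  rewrite derive_partial; last exact: gmx_diff.
  by rewrite -big_split; apply: eq_bigr => k _; rewrite christoffel_metric mulrDr.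
pose GY m := \sum_k \sum_i christoffel m k i p * v 0 k * Y p 0 i.
pose GZ m := \sum_k \sum_j christoffel m k j p * v 0 k * Z p 0 j.
transitivity
  (\sum_i \sum_j 'D_v (fun q => Y q 0 i) p * gmx g p i j * Z p 0 j +
   \sum_m \sum_j GY m * gmx g p m j * Z p 0 j +
   (\sum_i \sum_j Y p 0 i * gmx g p i j * 'D_v (fun q => Z q 0 j) p +
    \sum_i \sum_m Y p 0 i * gmx g p i m * GZ m)); last first.
  rewrite !gdotE -!big_split /=; apply: eq_bigr => i _.
  rewrite -!big_split /=; apply: eq_bigr => j _.
  by rewrite /nabla /dfield !mxE -/(GY i) -/(GZ j); ring.
have EY : \sum_m \sum_j GY m * gmx g p m j * Z p 0 j =
    \sum_i \sum_j Y p 0 i *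
      (\sum_k v 0 k * \sum_m christoffel m k i p * gmx g p m j) * Z p 0 j.
  rewrite exchange_big [in RHS]exchange_big /=; apply: eq_bigr => j _.
  rewrite -!mulr_suml; congr (_ * _).
  under eq_bigr do rewrite mulr_suml.
  rewrite exchange_big /= [in RHS](eq_bigr (fun i => \sum_k \sum_m
    christoffel m k i p * v 0 k * Y p 0 i * gmx g p m j)) => [|i _]; last first.
    rewrite mulr_sumr; apply: eq_bigr => k _; rewrite !mulr_sumr.
    by apply: eq_bigr => m _; ring.
  rewrite [in RHS]exchange_big /=; apply: eq_bigr => k _.
  rewrite [in RHS]exchange_big /=; apply: eq_bigr => m _.
  by rewrite mulr_suml.
have EZ : \sum_i \sum_m Y p 0 i * gmx g p i m * GZ m =
    \sum_i \sum_j Y p 0 i *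
      (\sum_k v 0 k * \sum_m christoffel m k j p * gmx g p i m) * Z p 0 j.
  apply: eq_bigr => i _.
  under eq_bigr do rewrite mulr_sumr.
  rewrite exchange_big /= [in RHS](eq_bigr (fun j => \sum_k \sum_m
    Y p 0 i * gmx g p i m * (christoffel m k j p * v 0 k * Z p 0 j)))
    => [|j _]; last first.
    rewrite mulr_sumr mulr_suml; apply: eq_bigr => k _.
    by rewrite !mulr_sumr mulr_suml; apply: eq_bigr => m _; ring.
  rewrite [in RHS]exchange_big /=; apply: eq_bigr => k _.
  rewrite [in RHS]exchange_big /=; apply: eq_bigr => m _.
  by rewrite mulr_sumr.
rewrite EY EZ -!big_split /=; apply: eq_bigr => i _.
rewrite -!big_split /=; apply: eq_bigr => j _.
by rewrite Dh DG; ring.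
Qed.

Inductive polyfun : ('rV[R]_n -> R) -> Prop :=
| polyfun_cst c : polyfun (fun=> c)
| polyfun_coord i : polyfun (fun q => q 0 i)
| polyfunD f h : polyfun f -> polyfun h -> polyfun (fun q => f q + h q)
| polyfunM f h : polyfun f -> polyfun h -> polyfun (fun q => f q * h q).

Lemma polyfun_sum I (r : seq I) (P : pred I) (F : I -> 'rV[R]_n -> R) :
  (forall i, polyfun (F i)) -> polyfun (fun q => \sum_(i <- r | P i) F i q).
Proof.
move=> pF; elim: r => [|i r IH].
  rewrite (_ : (fun _ => _) = fun=> 0); first exact: polyfun_cst.
  by apply/funext => q; rewrite big_nil.
case: (boolP (P i)) => Pi.
  rewrite (_ : (fun _ => _) = fun q => F i q + \sum_(i <- r | P i) F i q).
    exact: polyfunD.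
  by apply/funext => q; rewrite big_cons Pi.
rewrite (_ : (fun _ => _) = fun q => \sum_(i <- r | P i) F i q) //.
by apply/funext => q; rewrite big_cons (negbTE Pi).
Qed.

Lemma polyfun_diff f : polyfun f -> forall p, differentiable f p.
Proof.
elim=> [c|i|{}f h _ df _ dh|{}f h _ df _ dh] p.
- exact: differentiable_cst.
- exact: differentiable_coord.
- exact: (differentiableD (df p) (dh p)).
- exact: (differentiableM (df p) (dh p)).
Qed.

Lemma derive_coord k p v : 'D_v (fun q : 'rV[R]_n => q 0 k) p = v 0 k.
Proof.
rewrite deriveE; last exact: differentiable_coord.
have lin : linear (fun q : 'rV[R]_n => q 0 k) by move=> a x y; rewrite !mxE.
pose L := HB.pack_for {linear 'rV[R]_n -> R} (fun q : 'rV[R]_n => q 0 k)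
  (GRing.isLinear.Build _ _ _ _ _ lin).
by rewrite (_ : (fun q : 'rV[R]_n => q 0 k) = L)// diff_lin//; exact: coord_continuous.
Qed.

Lemma polyfun_partial i f : polyfun f -> polyfun (partial i f).
Proof.
elim=> [c|k|{}f h pf Df ph Dh|{}f h pf Df ph Dh].
- rewrite (_ : partial _ _ = fun=> 0); first exact: polyfun_cst.
  by apply/funext => q; exact: derive_cst.
- rewrite (_ : partial _ _ = fun=> (delta_mx 0 i : 'rV[R]_n) 0 k).
    exact: polyfun_cst.
  by apply/funext => q; exact: derive_coord.
- rewrite (_ : partial _ _ = fun q => partial i f q + partial i h q).
    exact: polyfunD.
  apply/funext => q; apply: (@deriveD _ _ _ f h);
    apply: diff_derivable; exact: polyfun_diff.
- rewrite (_ : partial _ _ = fun q => f q * partial i h q + h q * partial i f q).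
    by apply: polyfunD; exact: polyfunM.
  apply/funext => q; apply: (@deriveM _ _ f h);
    apply: diff_derivable; exact: polyfun_diff.
Qed.

Lemma polyfun_smooth f : polyfun f -> smooth f.
Proof.
move=> pf s; apply: polyfun_diff; elim: s => //= i s.
exact: polyfun_partial.
Qed.

End PseudoRiemannian.

Section EpsSpace.
Variables (R : realType) (n : nat) (hn : (2 < n)%N).

Fact coord_penult_subproof : (n - 2 < n)%N.
Proof. by rewrite ltn_subrL (ltn_trans _ hn). Qed.
Fact coord_last_subproof : (n - 1 < n)%N.
Proof. by rewrite ltn_subrL (ltn_trans _ hn). Qed.

(* Indices of the coordinates x_{n-1} and x_n: ordinals count from 0. *)
Definition penult : 'I_n := Ordinal coord_penult_subproof.
Definition last_ord : 'I_n := Ordinal coord_last_subproof.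

(* Gram matrix of the symmetric product dx_i dx_j. *)
Definition dxdx (i j : 'I_n) : 'M[R]_n :=
  2^-1 *: (delta_mx i j + delta_mx j i).

Definition eps_mx (eps : R) (p : 'rV[R]_n) : 'M[R]_n :=
  \sum_(i < n | (i < n - 2)%N) dxdx i i - dxdx penult last_ord
  + (eps * \sum_(i < n | (i < n - 2)%N) p 0 i ^+ 2) *: dxdx penult penult.

Lemma eps_mx_sym eps p : (eps_mx eps p)^T = eps_mx eps p.
Proof.
have dT i j : (dxdx i j)^T = dxdx i j.
  by rewrite /dxdx linearZ /= linearD /= !trmx_delta addrC.
rewrite /eps_mx; move: dxdx dT => D dT.
rewrite linearD linearB linearZ linear_sum /= !dT.
by congr (_ - _ + _); apply: eq_bigr => i _; exact: dT.
Qed.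

Lemma eps_mx_unit eps p : eps_mx eps p \in unitmx.
Proof.
set a := penult; set b := last_ord; rewrite /eps_mx -/a -/b.
set s := eps * _.
pose N : 'M[R]_n := \sum_(i < n | (i < n - 2)%N) dxdx i i.
pose H : 'M[R]_n := N + (- 4%:R) *: dxdx a b + (- 4%:R * s) *: dxdx b b.
have dd i : dxdx i i = delta_mx i i.
  by apply/matrixP => k l; rewrite !mxE; by field.
have ab : a != b.
  apply/eqP => /(congr1 val) /= ?; have := hn; lia.
have NE : N = \sum_(i < n | (i < n - 2)%N) delta_mx i i.
  by apply: eq_bigr => i _; rewrite dd.
have Nl (i j : 'I_n) : (n - 2 <= i)%N -> N *m delta_mx i j = 0.
  move=> hi; rewrite NE mulmx_suml big1// => k hk.
  by rewrite mul_delta_mx_0//; apply: contraTneq hk => ->; rewrite -leqNgt.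
have Nr (i j : 'I_n) : (n - 2 <= i)%N -> delta_mx j i *m N = 0.
  move=> hi; rewrite NE mulmx_sumr big1// => k hk.
  by rewrite mul_delta_mx_0//; apply: contraTneq hk => <-; rewrite -leqNgt.
have NN : N *m N = N.
  rewrite {1}NE mulmx_suml [RHS]NE; apply: eq_bigr => i hi.
  rewrite NE mulmx_sumr (bigD1 i)//= mul_delta_mx big1 ?addr0// => k /andP[_ ki].
  by rewrite mul_delta_mx_0// eq_sym.
have N1 : N + delta_mx a a + delta_mx b b = 1%:M.
  rewrite mx1_sum_delta (bigID (fun i : 'I_n => (i < n - 2)%N)) /= -NE -addrA.
  congr (_ + _); rewrite (bigD1 a) /= ?ltnn// (bigD1 b) /=; last first.
    by rewrite eq_sym ab andbT; have := hn; lia.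
  rewrite big1 ?addr0// => i /andP[/andP[h1 h2] h3]; exfalso.
  move: h2 h3; rewrite -!val_eqE /= => h2 h3.
  have := ltn_ord i; have := hn; lia.
have ha : (n - 2 <= a)%N by [].
have hb : (n - 2 <= b)%N by rewrite /= leq_sub2l.
suff /mulmx1_unit[] : (N - dxdx a b + s *: dxdx a a) *m H = 1%:M by [].
have dab (i j : 'I_n) : delta_mx i a *m delta_mx b j = 0 :> 'M[R]_n.
  by rewrite mul_delta_mx_0.
have dba (i j : 'I_n) : delta_mx i b *m delta_mx a j = 0 :> 'M[R]_n.
  by rewrite mul_delta_mx_0// eq_sym.
rewrite /H !dd /dxdx; move: N NN Nl Nr N1 {NE H} => N NN Nl Nr N1.
rewrite !(mulmxDl, mulmxDr, mulmxN, mulNmx) -!scalemxAl -!scalemxAr.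
rewrite !(mulmxDl, mulmxDr) NN !(Nl _ _ ha) !(Nl _ _ hb) !(Nr _ _ ha) !(Nr _ _ hb).
rewrite !mul_delta_mx !dab !dba.
rewrite -N1; apply/matrixP => i j; rewrite !mxE; by field.
Qed.

Lemma eps_mx_smooth eps i j : smooth (fun p => eps_mx eps p i j).
Proof.
apply: polyfun_smooth; rewrite (_ : (fun p => _) = fun p : 'rV[R]_n =>
  (\sum_(i < n | (i < n - 2)%N) dxdx i i - dxdx penult last_ord) i j +
  (eps * \sum_(i < n | (i < n - 2)%N) (p 0 i * p 0 i)) * dxdx penult penult i j).
  apply: polyfunD; first exact: polyfun_cst.
  apply: polyfunM; last exact: polyfun_cst.
  apply: polyfunM; first exact: polyfun_cst.
  by apply: polyfun_sum => k; apply: polyfunM; exact: polyfun_coord.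
by apply/funext => p; rewrite /eps_mx [LHS]mxE; congr (_ + _); rewrite [LHS]mxE.
Qed.

Definition eps_space (eps : R) : pseudo_metric R n :=
  PseudoMetric (eps_mx_sym eps) (eps_mx_unit eps) (eps_mx_smooth eps).

End EpsSpace.

(* Main.v *)
(* With a = n-1 and b = n, order the coordinates as a < {1, ..., n-2} < b.  The
   Levi-Civita connection of the eps-space is strictly triangular for this order:
   Gamma^j_(k i) = 0 unless j comes strictly after i.  So every curvature operator
   is strictly triangular, hence nilpotent, and all its eigenvalues are 0. *)
Require Import Defs.
From mathcomp Require Import all_boot all_order all_fingroup all_algebra.
From mathcomp Require Import all_classical all_reals all_analysis.
From mathcomp Require Import complex zify.

Import GRing.Theory Num.Theory.
Local Open Scope ring_scope.

Section RankTriangular.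
Local Set Implicit Arguments.
Local Unset Strict Implicit.
Variables (n : nat) (r : 'I_n -> nat).

(* A permutation s with r i < r (s i) whenever s i != i preserves the sum of the
   r i, hence is the identity: only the diagonal term of the Leibniz formula
   survives. *)
Lemma det_rank_trig (S : comNzRingType) (M : 'M[S]_n) :
  (forall i j, i != j -> (r j <= r i)%N -> M i j = 0) -> \det M = \prod_i M i i.
Proof.
move=> Mtrig; rewrite /determinant (bigD1 (1%g : 'S_n)) //= [X in _ + X]big1 ?addr0.
  rewrite odd_perm1 expr0 mul1r.
  by apply: eq_bigr => i _; rewrite perm1.
move=> s s_neq1.
suff [i /andP[si rsi]] : exists i, (i != s i) && (r (s i) <= r i)%N.
  by rewrite (bigD1 i) //= Mtrig // mul0r mulr0.
apply/existsP; apply: contra_neqT s_neq1; rewrite negb_exists => /forallP rs.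
have ler i : (r i <= r (s i))%N.
  have := rs i; rewrite negb_and negbK -ltnNge => /orP[/eqP {1}->|/ltnW] //.
have sum_rs : (\sum_i r i == \sum_i r (s i))%N.
  by rewrite [X in X == _](reindex_inj (@perm_inj _ s)).
have eqr i : r i = r (s i).
  have := leqif_sum (P := xpredT) (fun i _ => leqif_eq (ler i)).
  by case=> _; rewrite sum_rs => /esym/forallP/(_ i)/eqP.
apply/permP => i; rewrite perm1; apply/esym/eqP.
by have := rs i; rewrite -eqr leqnn andbT negbK.
Qed.

(** The weak inequality includes [i = j], so the diagonal of [M] vanishes and the diagonal of the
    characteristic matrix is ['X]. *)
Lemma char_poly_rank_trig (S : comNzRingType) (M : 'M[S]_n) :
  (forall i j, (r j <= r i)%N -> M i j = 0) -> char_poly M = 'X^n.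
Proof.
move=> Mtrig; rewrite /char_poly det_rank_trig => [|i j ij rji].
  rewrite (eq_bigr (fun=> 'X)) => [|i _].
    by rewrite prodr_const card_ord.
  by rewrite !mxE eqxx Mtrig // subr0.
by rewrite !mxE (negbTE ij) Mtrig // subr0.
Qed.

End RankTriangular.

Section TriangularConnection.
Local Set Implicit Arguments.
Local Unset Strict Implicit.
Variables (R : realType) (n : nat).

(** The difference quotient is identically zero. This handles derivatives of [nabla g X Z] without a
    smoothness proof. *)
Lemma derive_invariant (f : 'rV[R]_n -> R) p v :
  (forall h, f (h *: v + p) = f p) -> 'D_v f p = 0.
Proof.
move=> finv; rewrite /derive.
under eq_fun do rewrite /= finv subrr scaler0.
exact: lim_cst.
Qed.

Variables (g : pseudo_metric R n) (r : 'I_n -> nat).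
Hypothesis christoffel_trig : forall i j k p,
  (r j <= r i)%N -> christoffel g j k i p = 0.

(** In each Christoffel term either [r i <= m], where [Z] vanishes, or [r l <= m < r i], where the
    symbol does. Vanishing at every [q] kills the derivative term. *)
Lemma nabla_rank_vanish m (X Z : vfield R n) :
  (forall q l, (r l <= m)%N -> Z q 0 l = 0) ->
  forall q l, (r l <= m)%N -> nabla g X Z q 0 l = 0.
Proof.
move=> Z0 q l rl; rewrite /nabla !mxE derive_invariant => [|h]; last by rewrite !Z0.
rewrite add0r big1 // => k _; rewrite big1 // => i _.
have [ri|mi] := leqP (r i) m; first by rewrite Z0 ?mulr0.
by rewrite christoffel_trig ?mul0r // (leq_trans rl) // ltnW.
Qed.

(** Only the symbols with last lower index [i] remain. Rank [r i] itself is killed, which makes the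
    triangularity strict. *)
Lemma nabla_delta_vanish i (X : vfield R n) q l :
  (r l <= r i)%N -> nabla g X (fun=> delta_mx 0 i) q 0 l = 0.
Proof.
move=> rl; rewrite /nabla !mxE derive_invariant // add0r big1 // => k _.
rewrite big1 // => j _; rewrite mxE eqxx /=.
by have [->|_] := eqVneq j i; rewrite ?mulr0 // christoffel_trig ?mul0r.
Qed.

(** Row [i] is the image of the [i]-th frame field: a first [nabla] kills its components of rank at
    most [r i], and a second one keeps them zero. *)
Lemma curv_op_trig p u v i j : (r j <= r i)%N -> curv_op g p u v i j = 0.
Proof.
move=> rji.
have subE (A B C : 'rV[R]_n) : (A - (B - C)) 0 j = A 0 j - (B 0 j - C 0 j).
  by rewrite !mxE.
rewrite mxE /curvature subE nabla_delta_vanish //.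
rewrite !(@nabla_rank_vanish (r i)) ?subrr // => q l; exact: nabla_delta_vanish.
Qed.

Lemma ivanov_petrova_trig : ivanov_petrova g.
Proof.
suff char_polyX p u v : char_poly (map_mx (real_complex R) (skew_curv_op g p u v)) = 'X^n.
  by move=> p u v u' v' _ _ z; rewrite /eig_mult !char_polyX.
apply: (@char_poly_rank_trig _ r) => i j rji.
by rewrite mxE /skew_curv_op mxE curv_op_trig // mulr0 rmorph0.
Qed.

End TriangularConnection.

Section EpsConnection.
Local Set Implicit Arguments.
Local Unset Strict Implicit.
Variables (R : realType) (n : nat) (hn : (2 < n)%N) (eps : R).
Local Notation a := (penult hn).
Local Notation b := (last_ord hn).
Local Notation g := (eps_space hn eps).

Lemma penult_neq_last : a != b.
Proof. by rewrite -val_eqE /=; have := hn; lia. Qed.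

Lemma ordinal_cases (i : 'I_n) : [\/ i = a, i = b | (i < n - 2)%N].
Proof.
have [ilt|ige] := ltnP i (n - 2); first by constructor 3.
have [ia|ia] := eqVneq i a; first by constructor 1.
constructor 2; apply: val_inj; move: ia; rewrite -val_eqE /=.
have := ltn_ord i; have := hn; lia.
Qed.

Lemma eps_mxE p i j : gmx g p i j =
  ((i == j) && (i < n - 2)%N)%:R
  - 2^-1 * (((i == a) && (j == b))%:R + ((i == b) && (j == a))%:R)
  + (eps * \sum_(k < n | (k < n - 2)%N) p 0 k ^+ 2) * ((i == a) && (j == a))%:R.
Proof.
have halfD (x : R) : 2^-1 * (x + x) = x by rewrite mulrDr ![2^-1 * _]mulrC -splitr.
rewrite /= /eps_mx; set s := eps * _.
rewrite !mxE summxE; congr (_ - _ + _ * _); last exact: halfD.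
transitivity (\sum_(k < n | (k < n - 2)%N) ((i == k) && (j == k))%:R : R).
  by apply: eq_bigr => k _; rewrite !mxE halfD.
have [ilt|ige] := boolP (i < n - 2)%N.
  rewrite (bigD1 i) //= eqxx /= big1 ?addr0 ?andbT 1?eq_sym // => k /andP[_ ki].
  by rewrite eq_sym (negbTE ki).
rewrite andbF big1 // => k kn; case: eqP => //= ik.
by rewrite ik kn in ige.
Qed.

(** Only the entry at [(a, a)] varies, and it depends on the first [n - 2] coordinates alone. *)
Lemma partial_eps_mx0 k i j p :
  [|| k == b, i != a | j != a] -> partial k (fun q => gmx g q i j) p = 0.
Proof.
move=> kij; apply: derive_invariant => h; rewrite !eps_mxE.
have [ija|] := boolP ((i == a) && (j == a)); last by rewrite !mulr0.
have kb : k = b.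
  by apply/eqP; move: kij ija; case: (k == b) => //=; rewrite -negb_and => /negbTE ->.
congr (_ + eps * _ * _); apply: eq_bigr => l ln.
rewrite !mxE eqxx kb /= (_ : l == b = false) ?mulr0 ?add0r //.
by apply/negbTE; rewrite -val_eqE /=; lia.
Qed.

(** With [w] a basis vector, this reads a row of the inverse metric off a simple row of the
    metric. *)
Lemma row_invmx p i (w : 'rV[R]_n) c : c != 0 ->
  row i (gmx g p) = c *: w -> w *m invmx (gmx g p) = c^-1 *: delta_mx 0 i.
Proof.
move=> c0 rowi; apply: (canRL (scalerK c0)).
by rewrite scalemxAl -rowi -row_mul mulmxV ?gmx_unit // row1.
Qed.

Lemma invmx_penult p l : l != b -> invmx (gmx g p) a l = 0.
Proof.
move=> lb; have : row b (gmx g p) = (- 2^-1) *: delta_mx 0 a.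
  apply/rowP => j; rewrite mxE eps_mxE !mxE !eqxx [b == a]eq_sym.
  rewrite (negbTE penult_neq_last) /= add0r mulr0 addr0 mulNr.
  by rewrite (_ : (b < n - 2)%N = false) ?andbF ?sub0r //=; have := hn; lia.
move/row_invmx; rewrite oppr_eq0 invr_eq0 pnatr_eq0 => /(_ isT).
by rewrite -rowE => /rowP/(_ l); rewrite !mxE eqxx (negbTE lb) mulr0.
Qed.

Lemma invmx_spatial p (j l : 'I_n) : (j < n - 2)%N -> l != j -> invmx (gmx g p) j l = 0.
Proof.
move=> jn lj; have : row j (gmx g p) = 1 *: delta_mx 0 j.
  have ja : j == a = false by apply/negbTE; rewrite -val_eqE /=; lia.
  have jb : j == b = false by apply/negbTE; rewrite -val_eqE /=; lia.
  apply/rowP => k; rewrite mxE eps_mxE !mxE eqxx ja jb jn /=.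
  by rewrite addr0 !mulr0 subr0 addr0 andbT mul1r eq_sym.
move/row_invmx => /(_ (oner_neq0 _)).
by rewrite -rowE => /rowP/(_ l); rewrite !mxE eqxx (negbTE lj) mulr0.
Qed.

(** The spatial indices share one rank, so triangularity also excludes symbols from one spatial
    direction to another. *)
Definition eps_rank (i : 'I_n) : nat :=
  if i == a then 0 else if i == b then 2 else 1.

Lemma eps_christoffel_trig i j k p :
  (eps_rank j <= eps_rank i)%N -> christoffel g j k i p = 0.
Proof.
move=> rji; rewrite /christoffel big1 ?mulr0 // => l _.
have ba : b == a = false by rewrite eq_sym (negbTE penult_neq_last).
case: (ordinal_cases j) => [ja|jb|jn].
- rewrite ja; have [->|lb] := eqVneq l b; last by rewrite invmx_penult ?mul0r.
  by rewrite !partial_eps_mx0 ?ba ?eqxx ?orbT // subr0 addr0 mulr0.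
(* Rank 2 is attained only at [b]. Whatever [l] is, each derivative then has [b] as an index of its
   entry or as its direction. *)
- have ib : i = b.
    by move: rji; rewrite jb /eps_rank ba eqxx; case: eqP => // _; case: eqP.
  by rewrite ib !partial_eps_mx0 ?ba ?eqxx ?orbT // subr0 addr0 mulr0.
(* Only [l = j] remains. Each differentiated entry has [i] or [j], both distinct from [a], among its
   indices, so it is constant. *)
- have [->|lj] := eqVneq l j; last by rewrite invmx_spatial ?mul0r.
  have ja : j == a = false by apply/negbTE; rewrite -val_eqE /=; lia.
  have ia : i == a = false.
    by apply: contraTF rji => ia; rewrite /eps_rank ia ja; case: ifP.
  by rewrite !partial_eps_mx0 ?ia ?ja ?orbT // subr0 addr0 mulr0.
Qed.

End EpsConnection.

Theorem theorem4 (R : realType) (n : nat) (hn : (2 < n)%N) (eps : R)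
  (heps : eps = 1 \/ eps = -1) :
  ivanov_petrova (eps_space hn eps).
Proof. exact: ivanov_petrova_trig (@eps_christoffel_trig R n hn eps). Qed.
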